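(* Let $X$ be a finite metric space and let $k\ge 0$ be an integer. If $(s,[x])$ and $(t,[y])$ are layer points of $\Gamma_k(X)$, then their least upper bound $(u,[z])=(s,[x])\cup(t,[y])$ in $\Gamma_k(X)$ is a layer point.
   Context: For a finite metric space $(X,d)$, an integer $k\ge 0$ and $s\in[0,\infty]$, the degree Rips complex $L_{s,k}(X)$ is the simplicial complex whose simplices are the non-empty subsets $\tau\subset X$ such that $d(x,x')\le s$ for all $x,x'\in\tau$ and each $x\in\tau$ has at least $k$ distinct neighbours $y\in X$ (with $y\neq x$) such that $d(x,y)\le s$. For $s\le t$ there is an inclusion $L_{s,k}(X)\subset L_{t,k}(X)$. For a vertex $x$ of $L_{s,k}(X)$, $[x]$ or $[x]_s$ denotes its path component, regarded both as an element of $\pi_0L_{s,k}(X)$ and as a subset of $X$ (the set of vertices in that component). The poset $\Gamma_k(X)$ has elements the pairs $(s,[x])$ with $s\in[0,\infty]$ and $[x]\in\pi_0L_{s,k}(X)$, with $(s,[x])\le(t,[y])$ if and only if $s\le t$ and $[x]=[y]$ in $\pi_0L_{t,k}(X)$ (equivalently $s\le t$ and $[x]_s\subset[y]_t$). A layer point of $\Gamma_k(X)$ is an element $(t,[x])$ such that either 1) whenever $(s,[y])\le(t,[x])$ with $s<t$, the set $[y]_s$ is a proper subset of $[x]_t$, or 2) there is no relation $(s,[y])\le(t,[x])$ with $s<t$. Any two elements $(s,[x])$, $(t,[y])$ of $\Gamma_k(X)$ have a unique least upper bound $(s,[x])\cup(t,[y])=(u,[z])$ in $\Gamma_k(X)$: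 $u$ is the smallest parameter with $u\geq s,t$ and $[x]_u=[y]_u$ in $\pi_0L_{u,k}(X)$, and $[z]_u=[x]_u=[y]_u$. *)

(* Defs.v *)
From HB Require Import structures.
From mathcomp Require Import all_boot all_order all_algebra.
From mathcomp Require Import boolp classical_sets reals constructive_ereal ereal.
From mathcomp Require Import metric_structure.
From mathcomp Require Import fintype finset.

Set Implicit Arguments.
Unset Strict Implicit.
Unset Printing Implicit Defensive.

Import Order.TTheory GRing.Theory Num.Theory.

#[short(type="finMetricType")]
HB.structure Definition FinMetric (R : numDomainType) :=
  {X of Finite X & Metric R X}.

Section Complex.
Variables (X : finType).
Implicit Types (K : {set {set X}}) (x y : X).

Definition vertices K : {set X} := [set x | [set x] \in K].

(* For x = y this says that x is a vertex. *)
Definition edge K : rel X := fun x y => [set x; y] \in K.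

(* The path component of a vertex x, as a set of vertices: points joined to x
   by an edge path.  For x not a vertex the value is irrelevant. *)
Definition component K x : {set X} := [set y | connect (edge K) x y].

Definition pi0 K : {set {set X}} :=
  [set component K x | x in vertices K].

Lemma edge_connect_sym K : connect_sym (edge K).
Proof. by apply: sym_connect_sym => x y; rewrite /edge setUC. Qed.

Lemma component_refl K x : x \in component K x.
Proof. by rewrite inE. Qed.

Lemma mem_component_eq K x y :
  (y \in component K x) = (component K x == component K y).
Proof.
apply/idP/eqP => [|->]; last exact: component_refl.
rewrite inE => xy; apply/setP => z.
by rewrite !inE; apply: same_connect => //; exact: edge_connect_sym.
Qed.

Lemma component_mono K K' x : K \subset K' -> component K x \subset component K' x.
Proof.
move=> /subsetP KK'; apply/subsetP => y; rewrite !inE.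
by apply: connect_sub => a b ab; apply: connect1; exact: KK'.
Qed.

Lemma component_sub K K' x y : K \subset K' ->
  (component K x \subset component K' y) = (component K' x == component K' y).
Proof.
move=> KK'; apply/idP/eqP => [/subsetP/(_ _ (component_refl K x))|<-].
  by rewrite mem_component_eq => /eqP.
exact: component_mono.
Qed.

End Complex.

Fact gamma_display : Order.disp_t. Proof. exact: Order.Disp tt tt. Qed.

Section DegreeRips.
Context {R : realType} {X : finMetricType R}.
Variable k : nat.
Implicit Types (s t u : \bar R) (x y : X) (tau : {set X}).
Local Open Scope ereal_scope.

Definition neighbours s x : {set X} :=
  [set y | (y != x) && ((mdist x y)%:E <= s)].

Definition degRips s : {set {set X}} :=
  [set tau : {set X} |
    [&& tau != set0,
        [forall x in tau, forall x' in tau, (mdist x x')%:E <= s] &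
        [forall x in tau, (k <= #|neighbours s x|)%N]]].

Lemma degRipsP s tau :
  reflect [/\ tau != set0,
              {in tau &, forall x x', (mdist x x')%:E <= s} &
              {in tau, forall x, (k <= #|neighbours s x|)%N}]
          (tau \in degRips s).
Proof.
rewrite inE; apply: (iffP and3P) => -[t0 td tk]; split=> //.
- by move=> x x' xt x't; move/forall_inP: td => /(_ _ xt) /forall_inP /(_ _ x't).
- by move=> x xt; move/forall_inP: tk; exact.
- by apply/forall_inP => x xt; apply/forall_inP => x' x't; exact: td.
- by apply/forall_inP => x xt; exact: tk.
Qed.

Lemma degRips_subset s tau tau' : tau' != set0 -> tau' \subset tau ->
  tau \in degRips s -> tau' \in degRips s.
Proof.
move=> t0 /subsetP sub /degRipsP[_ td tk]; apply/degRipsP; split=> //.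
- by move=> x x' /sub xt /sub; exact: td.
- by move=> x /sub; exact: tk.
Qed.

Lemma degRips_le s t :
  (forall x y, (mdist x y)%:E <= s -> (mdist x y)%:E <= t) ->
  degRips s \subset degRips t.
Proof.
move=> st; apply/subsetP => tau /degRipsP[t0 td tk]; apply/degRipsP; split=> //.
- by move=> x x' xt x't; apply: st; exact: td.
- move=> x /tk /leq_trans; apply; apply: subset_leq_card; apply/subsetP => y.
  by rewrite !inE => /andP[-> /st].
Qed.

Lemma degRips_mono s t : s <= t -> degRips s \subset degRips t.
Proof. by move=> st; apply: degRips_le => x y /le_trans; exact. Qed.

Lemma vertices_mono s t x : s <= t ->
  x \in vertices (degRips s) -> x \in vertices (degRips t).
Proof.
by move=> st; rewrite /vertices in_set => xs; rewrite in_set; exact: (subsetP (degRips_mono st)).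
Qed.

Lemma component_pinfty s t x y :
  x \in vertices (degRips s) -> y \in vertices (degRips t) ->
  component (degRips +oo) x = component (degRips +oo) y.
Proof.
have vk u z : z \in vertices (degRips u) -> (k <= #|neighbours +oo z|)%N.
  move=> /(vertices_mono (leey u)); rewrite in_set => /degRipsP[_ _]; apply.
  exact: set11.
move=> /vk kx /vk ky; apply/eqP; rewrite -mem_component_eq inE.
apply: connect1; apply/degRipsP; split=> [|? ? _ _|z]; rewrite ?leey //.
  by apply/set0Pn; exists x; exact: set21.
by move=> /set2P[->|->].
Qed.

Definition GammaP (p : \bar R * {set X}) : bool :=
  (0 <= p.1) && (p.2 \in pi0 (degRips p.1)).

(* A pair (s, [x]) consists of s >= 0 and a path component of L_{s,k}(X), the
   latter given by its set of vertices. *)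
Record Gamma := MkGamma { gamma_val :> \bar R * {set X}; _ : GammaP gamma_val }.

HB.instance Definition _ := [isSub for gamma_val].
HB.instance Definition _ := [Choice of Gamma by <:].

Implicit Types p q r : Gamma.

Definition gparam p : \bar R := p.1.
Definition gcomp p : {set X} := p.2.

Lemma gamma_point_subproof s x : 0 <= s -> x \in vertices (degRips s) ->
  GammaP (s, component (degRips s) x).
Proof. by move=> s0 xV; rewrite /GammaP s0 /=; exact: imset_f. Qed.

Definition gamma_point s x (s0 : 0 <= s) (xV : x \in vertices (degRips s)) :=
  MkGamma (gamma_point_subproof s0 xV).

Lemma gparam_ge0 p : 0 <= gparam p.
Proof. by have /andP[] := valP p. Qed.

Lemma base_subproof p : exists x, (x \in vertices (degRips (gparam p))) &&
  (gcomp p == component (degRips (gparam p)) x).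
Proof.
by have /andP[_ /imsetP[x xV Cx]] := valP p; exists x; rewrite xV; apply/eqP.
Qed.

Definition base p : X := xchoose (base_subproof p).

Lemma base_vertex p : base p \in vertices (degRips (gparam p)).
Proof. by have /andP[] := xchooseP (base_subproof p). Qed.

Lemma gcompE p : gcomp p = component (degRips (gparam p)) (base p).
Proof. by have /andP[_ /eqP] := xchooseP (base_subproof p). Qed.

Definition gamma_le p q := (gparam p <= gparam q) && (gcomp p \subset gcomp q).

Lemma gamma_leE p q : gamma_le p q = (gparam p <= gparam q) &&
  (component (degRips (gparam q)) (base p) == gcomp q).
Proof.
rewrite /gamma_le; case: leP => //= pq; rewrite !gcompE.
by rewrite component_sub // degRips_mono.
Qed.

Lemma gamma_le_refl : reflexive gamma_le.
Proof. by move=> p; rewrite /gamma_le lexx subxx. Qed.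

Lemma gamma_le_anti : antisymmetric gamma_le.
Proof.
move=> p q /andP[/andP[pq Cpq] /andP[qp Cqp]]; apply: val_inj.
have spq : gparam p = gparam q by apply: le_anti; rewrite pq.
have Cpq' : gcomp p = gcomp q by apply/eqP; rewrite eqEsubset Cpq.
by rewrite [LHS]surjective_pairing [RHS]surjective_pairing; congr pair.
Qed.

Lemma gamma_le_trans : transitive gamma_le.
Proof.
move=> q p r /andP[pq Cpq] /andP[qr Cqr].
by rewrite /gamma_le (le_trans pq qr) (subset_trans Cpq Cqr).
Qed.

(* The parameters u >= s, t at which [x]_u = [y]_u. *)
Definition merged p q u : bool :=
  [&& gparam p <= u, gparam q <= u &
      component (degRips u) (base p) == component (degRips u) (base q)].

Definition join_param p q : \bar R := ereal_inf [set u | merged p q u]%classic.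

Let cand p q (i : option (X * X)) : \bar R :=
  if i is Some xy then (mdist xy.1 xy.2)%:E
  else Order.max (gparam p) (gparam q).

Lemma merged_cand p q u : merged p q u ->
  exists2 i, merged p q (cand p q i) & cand p q i <= u.
Proof.
move=> /and3P[pu qu xy]; pose P i := cand p q i <= u.
have P0 : P None by rewrite /P /= ge_max pu.
case: (arg_maxP (cand p q) P0) => i Pi imax; exists i => //.
have := imax _ P0; rewrite /= ge_max => /andP[pi qi].
rewrite /merged pi qi /=.
suff -> : degRips (cand p q i) = degRips u by [].
apply/eqP; rewrite eqEsubset degRips_mono //=.
by apply: degRips_le => x y xyu; exact: (imax (Some (x, y))).
Qed.

Lemma merged_join_param p q : merged p q (join_param p q).
Proof.
have moo : merged p q +oo.
  by rewrite /merged !leey /= (component_pinfty (base_vertex p) (base_vertex q)).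
have [i0 mi0 _] := merged_cand moo.
case: (@arg_minP _ _ _ i0 (fun i => merged p q (cand p q i)) (cand p q) mi0).
move=> i mi imin; suff -> : join_param p q = cand p q i by [].
apply/eqP; rewrite eq_le; apply/andP; split; first exact: ereal_inf_lbound.
apply: le_ereal_inf_tmp => u /= /merged_cand[j mj]; apply: le_trans; exact: imin.
Qed.

Lemma join_param_le p q u : merged p q u -> join_param p q <= u.
Proof. by move=> mu; exact: ereal_inf_lbound. Qed.

Lemma join_subproof p q : GammaP
  (join_param p q, component (degRips (join_param p q)) (base p)).
Proof.
have /and3P[pu _ _] := merged_join_param p q.
apply: gamma_point_subproof; first exact: le_trans (gparam_ge0 p) pu.
exact: vertices_mono pu (base_vertex p).
Qed.

Definition gamma_join p q : Gamma := MkGamma (join_subproof p q).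

Lemma gamma_leUx p q r :
  gamma_le (gamma_join p q) r = gamma_le p r && gamma_le q r.
Proof.
have /and3P[pu qu /eqP xy] := merged_join_param p q.
apply/idP/andP => [jr|[]].
  split; apply: gamma_le_trans jr; rewrite gamma_leE ?pu ?qu /=.
  - by apply/eqP.
  - by apply/eqP; rewrite -xy.
rewrite (gamma_leE p) (gamma_leE q) => /andP[pr /eqP Cp] /andP[qr /eqP Cq].
have ur : join_param p q <= gparam r.
  by apply: join_param_le; rewrite /merged pr qr Cp Cq eqxx.
rewrite /gamma_le ur /= -Cp.
exact: (component_mono (base p) (degRips_mono ur)).
Qed.

HB.instance Definition _ := Order.Le_isPOrder.Build gamma_display Gamma
  gamma_le_refl gamma_le_anti gamma_le_trans.

HB.instance Definition _ := Order.POrder_isJoinSemilattice.Build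
  gamma_display Gamma gamma_leUx.

Lemma gamma_pointE p : exists s x (s0 : 0 <= s)
  (xV : x \in vertices (degRips s)), p = gamma_point s0 xV.
Proof.
exists (gparam p), (base p), (gparam_ge0 p), (base_vertex p).
by apply: val_inj; rewrite /= -gcompE -surjective_pairing.
Qed.

Lemma le_gamma_point s t x y (s0 : 0 <= s) (t0 : 0 <= t)
    (xV : x \in vertices (degRips s)) (yV : y \in vertices (degRips t)) :
  (gamma_point s0 xV <= gamma_point t0 yV)%O =
  (s <= t) && (component (degRips t) x == component (degRips t) y).
Proof.
rewrite [LHS]/Order.le /= /gamma_le /gparam /gcomp /=; case: leP => //= st.
by rewrite component_sub // degRips_mono.
Qed.

(* The join is the point (u, [z]) with u the least parameter above s and t at
   which [x]_u = [y]_u, and [z]_u = [x]_u. *)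
Lemma join_gamma_point s t x y (s0 : 0 <= s) (t0 : 0 <= t)
    (xV : x \in vertices (degRips s)) (yV : y \in vertices (degRips t))
    (r := (gamma_point s0 xV `|` gamma_point t0 yV)%O) (u := gparam r) :
  [/\ s <= u, t <= u,
      gcomp r = component (degRips u) x,
      gcomp r = component (degRips u) y &
      forall v, s <= v -> t <= v ->
        component (degRips v) x = component (degRips v) y -> u <= v].
Proof.
have := lexx r; rewrite leUx => /andP[].
rewrite {1}/Order.le {1 3}/Order.le /= /gamma_le => /andP[su xr] /andP[tu yr].
have eqr z w : w <= u -> component (degRips w) z \subset gcomp r ->
    gcomp r = component (degRips u) z.
  move=> wu; rewrite gcompE component_sub ?degRips_mono //.
  by move=> /eqP.
split=> //; [exact: eqr xr|exact: eqr yr|] => v sv tv xy.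
have v0 := le_trans s0 sv; have xVv := vertices_mono sv xV.
suff : (r <= gamma_point v0 xVv)%O by case/andP.
by rewrite leUx !le_gamma_point sv tv eqxx -xy eqxx.
Qed.

Definition layer_point p : Prop :=
  (forall q, (q <= p)%O -> gparam q < gparam p -> gcomp q \proper gcomp p) \/
  ~ exists q, (q <= p)%O /\ gparam q < gparam p.

End DegreeRips.

Arguments Gamma {R} X k.

(* Main.v *)
Require Import Defs.
From mathcomp Require Import all_boot all_order all_algebra.
From mathcomp Require Import reals metric_structure.
From mathcomp Require Import constructive_ereal.

Import Order.TTheory.

(** A layer point is a point of Gamma_k(X) that is the earliest one with its
    set of vertices ([layer_pointE]).  It is then even the earliest one among
    all points whose set of vertices contains its own: the order from a layer
    point upwards is plain inclusion of vertex sets ([layer_point_le]).  The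
    reason is that an earlier component can contain a later one only by being
    equal to it, since components grow with the parameter ([gcomp_sub_eq]).

    Now let r be a point below the join of two layer points with the same
    vertex set as the join.  This set contains the vertex sets of both layer
    points, so both lie below r, and hence so does their join.  Thus r is not
    earlier than the join, and the join is a layer point. *)

Section LayerPoints.
Context {R : realType} {X : finMetricType R} {k : nat}.
Implicit Types p q r : Gamma X k.
Local Open Scope order_scope.

Lemma gamma_leP p q :
  reflect (gparam p <= gparam q /\ gcomp p \subset gcomp q) (p <= q).
Proof. exact: andP. Qed.

(** At the later parameter of q, the component of p grows to a component that
    contains the one of q.  Two components at the same parameter that meet are
    equal, so the component of p is also included in the one of q. *)
Lemma gcomp_sub_eq p q : gparam p <= gparam q ->
  gcomp q \subset gcomp p -> gcomp p = gcomp q.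
Proof.
move=> pq qp; apply/eqP; rewrite eqEsubset qp andbT.
have Kpq := degRips_mono (X := X) k pq.
have := subset_trans qp; rewrite !gcompE => /(_ _ (component_mono _ Kpq)).
by rewrite !component_sub // => /eqP ->.
Qed.

(** Both clauses in the definition of a layer point say this: the inclusion of
    vertex sets below p is automatic, so it is proper unless it is an equality,
    and the second clause makes the condition vacuous. *)
Lemma layer_pointE p : layer_point p <->
  forall r, r <= p -> gcomp r = gcomp p -> gparam p <= gparam r.
Proof.
split=> [lp r rp Crp | first_p].
  rewrite leNgt; apply/negP => ltrp; case: lp => [/(_ r rp ltrp) | []].
    by rewrite Crp properxx.
  by exists r.
left=> r rp ltrp; have /gamma_leP[_ subrp] := rp.
rewrite properEneq subrp andbT; apply/eqP => /(first_p r rp).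
by rewrite leNgt ltrp.
Qed.

(** If r comes no later than p, then its component equals that of p, and p is
    the earliest point with this set of vertices. *)
Lemma layer_point_le p r :
  layer_point p -> gcomp p \subset gcomp r -> p <= r.
Proof.
move=> /layer_pointE first_p subpr; apply/gamma_leP; split=> //.
have /orP[//|le_rp] := le_total (gparam p) (gparam r).
have Crp := gcomp_sub_eq _ _ le_rp subpr.
by apply: first_p => //; apply/gamma_leP; rewrite Crp.
Qed.

End LayerPoints.

Theorem lemma4 (R : realType) (X : finMetricType R) (k : nat) (p q : Gamma X k)
  (hp : layer_point p) (hq : layer_point q) :
  layer_point (p `|` q)%O.
Proof.
apply/layer_pointE => r _ Cr.
have /gamma_leP[_ subp] := leUl p q.
have /gamma_leP[_ subq] := leUr q p.
suff /gamma_leP[] : (p `|` q <= r)%O by [].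
by rewrite leUx !layer_point_le ?Cr.
Qed.
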